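(* Let $q$ be $1$ or a prime power $\ge2$, and let $0\le t\le k\le n$ be integers. Let $\lambda_{\min}$ be the smallest positive integer $\lambda$ such that the parameters $t$-$(n,k,\lambda)_q$ are admissible, and let $\lambda_{\max}={n-t\brack k-t}_q$. Then $$\lambda_{\min}=\frac{{n-t\brack k-t}_q}{\gcd\left({n\brack k}_q,{n-1\brack k-1}_q,\ldots,{n-t\brack k-t}_q\right)}=\frac{\lambda_{\max}}{\gcd\left({n\brack k}_q,{n-1\brack k-1}_q,\ldots,{n-t\brack k-t}_q\right)} .$$ Moreover, regarding the Gaussian binomial coefficients as polynomials in $\mathbb{Z}[q]$ ($q$ an indeterminate), the greatest common divisor in $\mathbb{Z}[q]$ has the factorization into irreducibles $$\gcd\left({n\brack k}_q,{n-1\brack k-1}_q,\ldots,{n-t\brack k-t}_q\right)=\prod_{\substack{i\in\mathbb{Z}_{>0}\\ t\le(n\bmod i)<(k\bmod i)}}\Phi_i .$$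
   Context: ${n\brack k}_q$ is the Gaussian binomial coefficient (the ordinary binomial coefficient for $q=1$); for fixed $0\le k\le n$ it is a polynomial in $q$ with integer coefficients. $\Phi_i\in\mathbb{Z}[q]$ is the $i$-th cyclotomic polynomial, and $(a\bmod i)\in\{0,\ldots,i-1\}$ is the remainder of $a$ on division by $i$. For an integer $\lambda$, the parameters $t$-$(n,k,\lambda)_q$ are admissible if for every $s\in\{0,\ldots,t\}$ the number $\lambda_s=\frac{{n-s\brack k-s}_q}{{n-t\brack k-t}_q}\cdot\lambda$ is an integer. In the first formula the gcd is that of integers (for the given value of $q$); in the second formula it is the gcd in $\mathbb{Z}[q]$ (up to sign). *)

(* Defs.v *)
From mathcomp Require Import all_boot all_order all_algebra all_field.

Set Implicit Arguments.
Unset Strict Implicit.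
Unset Printing Implicit Defensive.

Import Order.TTheory GRing.Theory Num.Theory.
Local Open Scope ring_scope.

Definition gauss_num (n k : nat) : {poly int} := \prod_(i < k) ('X^(n - i) - 1).
Definition gauss_den (k : nat) : {poly int} := \prod_(i < k) ('X^(i.+1) - 1).

(* The Gaussian binomial coefficient as a polynomial. The divisor is monic and
   the division is exact: see [gauss_binE]. *)
Definition gauss_bin (n k : nat) : {poly int} := gauss_num n k %/ gauss_den k.

(* Evaluation of the polynomial, so that q = 1 makes sense: see
   [gauss_val1]. *)
Definition gauss_val (q n k : nat) : int := (gauss_bin n k).[q%:Z].

Lemma gauss_den_monic k : gauss_den k \is monic.
Proof. by apply: monic_prod => i _; apply: monicXnsubC. Qed.

Lemma gauss_bin_exists n k : exists g : {poly int},
  [/\ gauss_num n k = g * gauss_den k, g.[1] = 'C(n, k)%:Z,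
      forall q : nat, 0 <= g.[q%:Z]
    & forall q : nat, (0 < q)%N -> (k <= n)%N -> 0 < g.[q%:Z]].
Proof.
elim: n k => [|n IHn] [|k].
- by exists 1; split=> [||q|q _ _]; rewrite /gauss_num /gauss_den ?big_ord0 ?mulr1 ?hornerC.
- exists 0; split=> [||q|q _] //; rewrite ?horner0 ?mul0r //.
  by rewrite /gauss_num big_ord_recl subnn expr0 subrr mul0r.
- by exists 1; split=> [||q|q _ _];
    rewrite /gauss_num /gauss_den ?big_ord0 ?mulr1 ?hornerC ?bin0.
have [g [gE g1 g0 gp]] := IHn k; have [h [hE h1 h0 hp]] := IHn k.+1.
exists (g + 'X^(k.+1) * h); split.
- have NS : gauss_num n.+1 k.+1 = ('X^(n.+1) - 1) * gauss_num n k.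
    by rewrite /gauss_num big_ord_recl subn0; congr (_ * _).
  have NR : gauss_num n k.+1 = gauss_num n k * ('X^(n - k) - 1).
    by rewrite /gauss_num big_ord_recr.
  have DS : gauss_den k.+1 = gauss_den k * ('X^(k.+1) - 1).
    by rewrite /gauss_den big_ord_recr.
  rewrite mulrDl -mulrA -hE DS mulrA -gE NS NR.
  have [kn | nk] := leqP k n; last first.
    have -> : gauss_num n k = 0.
      by rewrite /gauss_num (bigD1 (Ordinal nk)) //= subnn expr0 subrr mul0r.
    by rewrite !(mulr0, mul0r, addr0).
  rewrite (mulrC ('X^(n.+1) - 1)) mulrCA -mulrDr; congr (_ * _).
  by rewrite mulrBr mulr1 -exprD addSn subnKC // [RHS]addrC addrA subrK.
- by rewrite hornerD hornerM hornerXn expr1n mul1r g1 h1 binS addnC.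
- move=> q; rewrite hornerD hornerM hornerXn.
  by rewrite addr_ge0 ?g0 // mulr_ge0 ?h0 ?exprn_ge0.
move=> q q0 kn; rewrite hornerD hornerM hornerXn.
by rewrite ltr_wpDr ?gp // mulr_ge0 ?h0 ?exprn_ge0.
Qed.

Lemma gauss_binE n k : gauss_bin n k * gauss_den k = gauss_num n k.
Proof.
have [g [gE _ _ _]] := gauss_bin_exists n k.
by rewrite /gauss_bin gE Pdiv.IdomainMonic.mulpK ?gauss_den_monic.
Qed.

Lemma gauss_val1 n k : gauss_val 1 n k = 'C(n, k)%:Z.
Proof.
have [g [gE g1 _ _]] := gauss_bin_exists n k.
by rewrite /gauss_val /gauss_bin gE Pdiv.IdomainMonic.mulpK ?gauss_den_monic.
Qed.

Lemma gauss_val_gt0 q n k : (0 < q)%N -> (k <= n)%N -> 0 < gauss_val q n k.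
Proof.
have [g [gE _ _ gp]] := gauss_bin_exists n k => q0 kn.
rewrite /gauss_val /gauss_bin gE Pdiv.IdomainMonic.mulpK ?gauss_den_monic //.
exact: gp.
Qed.

Definition lambda_s (q t n k : nat) (lambda : int) (s : nat) : rat :=
  (gauss_val q (n - s) (k - s))%:~R / (gauss_val q (n - t) (k - t))%:~R
    * lambda%:~R.

Definition admissible (q t n k : nat) (lambda : int) : bool :=
  [forall s : 'I_t.+1, lambda_s q t n k lambda s \is a Num.int].

(* If the denominator vanishes (impossible for 0 < q and t <= k <= n), then
   every lambda is admissible, so no hypothesis is needed. *)
Lemma admissible_exists q t n k :
  exists l : nat, (0 < l)%N && admissible q t n k l%:Z.
Proof.
set d := gauss_val q (n - t) (k - t).
have [d0 | dN0] := eqVneq d 0.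
  by exists 1%N; apply/forallP=> s; rewrite /lambda_s -/d d0 invr0 mulr0 mul0r rpred0.
exists `|d|%N; rewrite absz_gt0 dN0 /=; apply/forallP=> s.
rewrite /lambda_s -/d abszEsign intrM mulrCA.
have dQ0 : d%:~R != 0 :> rat by rewrite intr_eq0.
by rewrite divfK // -intrM intr_int.
Qed.

Definition lambda_min (q t n k : nat) : nat := ex_minn (admissible_exists q t n k).

Definition lambda_max (q t n k : nat) : int := gauss_val q (n - t) (k - t).

Definition gauss_gcd (q t n k : nat) : int :=
  \big[gcdz/0]_(s < t.+1) gauss_val q (n - s) (k - s).

(* MathComp's [%|], [gcdp] and [irreducible_poly] on {poly int} are
   pseudo-division notions, insensitive to integer factors; the following are
   the ring-theoretic ones. *)
Definition ring_dvd (R : idomainType) (a b : R) : Prop := exists c, b = c * a.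

Definition is_gcd (R : idomainType) (I : Type) (f : I -> R) (g : R) : Prop :=
  (forall i, ring_dvd g (f i)) /\
  (forall d, (forall i, ring_dvd d (f i)) -> ring_dvd d g).

Definition irreducible_elt (R : idomainType) (p : R) : Prop :=
  [/\ p != 0, p \isn't a GRing.unit
    & forall a b, p = a * b -> a \is a GRing.unit \/ b \is a GRing.unit].

Definition cyc_index (t n k i : nat) : bool :=
  [&& 0 < i, t <= n %% i & n %% i < k %% i]%N.

(* Hence the product over all positive i satisfying the condition is a product
   over 1 <= i <= n. *)
Lemma cyc_index_le t n k i : (k <= n)%N -> cyc_index t n k i -> (i <= n)%N.
Proof.
move=> kn /and3P[_ _ ]; apply: contraTT; rewrite -ltnNge -leqNgt => ni.
by rewrite !modn_small // (leq_ltn_trans kn).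
Qed.

(* Main.v *)
(** 'Phi_d divides \prod_(i < n) (q^(i+1) - 1) exactly n %/ d times,
    so its exponent in the Gaussian binomial of (n, k) is the carry
    n %/ d - k %/ d - (n - k) %/ d, that is 1 if n %% d < k %% d and 0
    otherwise. The Gaussian binomials are thus products of distinct primes of
    Z[X], and their gcd collects the 'Phi_i common to all of them, by the
    criterion [cyc_indexP]. For the integer part, with D the Gaussian binomial
    of (n - t, k - t) and G the gcd, lambda is admissible iff D divides
    lambda * G, that is, iff D / G divides lambda. *)
Require Import Defs.
From mathcomp Require Import all_boot all_order all_algebra all_field.
From mathcomp Require Import zify.

Set Implicit Arguments.
Unset Strict Implicit.
Unset Printing Implicit Defensive.

Import Order.TTheory GRing.Theory Num.Theory.
Local Open Scope ring_scope.

(** * Cyclotomic factorization of the Gaussian binomials *)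

Lemma gauss_denS k : gauss_den k.+1 = gauss_den k * ('X^(k.+1) - 1).
Proof. by rewrite /gauss_den big_ord_recr. Qed.

Lemma gauss_num_den n k : (k <= n)%N ->
  gauss_num n k * gauss_den (n - k) = gauss_den n.
Proof.
elim: k => [|k IHk] kn; first by rewrite /gauss_num big_ord0 mul1r subn0.
rewrite -[RHS]IHk 1?ltnW // /gauss_num big_ord_recr /= -mulrA; congr (_ * _).
by rewrite -(subnSK kn) gauss_denS mulrC.
Qed.

(** ['X^j - 1] is the product of the ['Phi_d] with [d] dividing [j], and [m %/ d] of the numbers
    from 1 to [m] are multiples of [d]. The bound [N] gives such products a common index range;
    indices above [m] get exponent 0. *)
Lemma gauss_den_Cyclotomic N m : (m < N)%N ->
  gauss_den m = \prod_(1 <= d < N) 'Phi_d ^+ (m %/ d).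
Proof.
elim: m => [|m IHm] mN.
  by rewrite /gauss_den big_ord0 big1 // => d _; rewrite div0n expr0.
rewrite gauss_denS IHm 1?ltnW // -prod_Cyclotomic //.
have -> : \prod_(d <- divisors m.+1) 'Phi_d
          = \prod_(1 <= d < N | (d %| m.+1)%N) 'Phi_d.
  rewrite -[RHS]big_filter; apply/perm_big/uniq_perm.
  - exact: divisors_uniq.
  - exact/filter_uniq/iota_uniq.
  - move=> d; rewrite mem_filter -dvdn_divisors // mem_index_iota.
    have [dm|//] := boolP (d %| m.+1)%N.
    by rewrite (dvdn_gt0 _ dm) //= (leq_ltn_trans (dvdn_leq _ dm)).
rewrite [X in _ * X]big_mkcond -big_split /= !big_seq.
apply: eq_bigr => d; rewrite mem_index_iota => /andP[d0 _].
by rewrite divnS // exprD mulrC; case: (d %| m.+1)%N.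
Qed.

(** By [divnD] there is a carry iff [d <= k %% d + (n - k) %% d]. Then [n %% d] is this sum minus
    [d], which is below [k %% d]; otherwise it is the sum itself. *)
Lemma divn_sub_carry n k d : (0 < d)%N -> (k <= n)%N ->
  (n %/ d = k %/ d + (n - k) %/ d + (n %% d < k %% d))%N.
Proof.
move=> d0 kn; rewrite -{1}(subnKC kn) divnD //; congr (_ + nat_of_bool _)%N.
have := modnD k (n - k) d0; rewrite subnKC //.
have := ltn_pmod k d0; have := ltn_pmod (n - k) d0.
by case: leqP => /=; lia.
Qed.

Lemma gauss_bin_Cyclotomic N n k : (n < N)%N -> (k <= n)%N ->
  gauss_bin n k = \prod_(1 <= d < N | (n %% d < k %% d)%N) 'Phi_d.
Proof.
move=> nN kn; have denN0 m : gauss_den m != 0 by rewrite monic_neq0 ?gauss_den_monic.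
(* With both denominators cleared, only exponents remain to be compared. *)
apply: (mulIf (denN0 k)); apply: (mulIf (denN0 (n - k)%N)).
rewrite gauss_binE gauss_num_den //.
rewrite !(@gauss_den_Cyclotomic N) ?(leq_ltn_trans _ nN) ?leq_subr //.
rewrite [X in X * _ * _]big_mkcond -!big_split /= !big_seq.
apply: eq_bigr => d; rewrite mem_index_iota => /andP[d0 _].
rewrite (divn_sub_carry d0 kn) !exprD mulrC mulrA.
by case: ifP; rewrite ?expr0 ?expr1.
Qed.

(** * Cyclotomic polynomials as primes of Z[X] *)

(* 'Phi_n is monic, so the remainder of [a] modulo 'Phi_n exists over the
   integers; it vanishes at [z] and has degree less than the minimal polynomial
   of [z]. *)
Lemma ring_dvd_Cyclotomic n (z : algC) (a : {poly int}) : n.-primitive_root z ->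
  ring_dvd 'Phi_n a <-> root (map_poly intr a) z.
Proof.
move=> prim_z.
have root_Phi : root (map_poly intr 'Phi_n) z.
  by rewrite (Cintr_Cyclotomic prim_z) root_cyclotomic.
split=> [[c ->]|az]; first by rewrite rmorphM rootM root_Phi orbT.
have mon := Cyclotomic_monic n.
have aE := Pdiv.IdomainMonic.divp_eq mon a.
set r := a %% 'Phi_n in aE; exists (a %/ 'Phi_n).
suff r0 : r = 0 by rewrite {1}aE r0 addr0.
have rz : root (map_poly intr r) z.
  move: az; rewrite aE rmorphD rmorphM /root hornerD hornerM.
  by rewrite (rootP root_Phi) mulr0 add0r.
have [p [pE _] p_dvd] := minCpolyP z.
have rQ : map_poly ratr (map_poly intr r : {poly rat}) = map_poly intr r :> {poly algC}.
  by rewrite -map_poly_comp; apply: eq_map_poly => x /=; rewrite ratr_int.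
have size_p : size p = size 'Phi_n.
  rewrite -(size_map_poly (ratr : rat -> algC)) -pE (minCpoly_cyclotomic prim_z).
  by rewrite size_cyclotomic size_Cyclotomic.
have inj0 : injective (intr : int -> rat) := intr_inj.
have : (p %| (map_poly intr r : {poly rat})) by rewrite -p_dvd rQ.
have [//|rN0] := eqVneq r 0 => /dvdp_leq.
rewrite map_poly_eq0_id0 ?intr_eq0 ?lead_coef_eq0 // => /(_ rN0).
rewrite size_map_inj_poly // size_p leqNgt.
by rewrite ltn_modp monic_neq0.
Qed.

(** Divisibility by ['Phi_n] is vanishing at a point of the field [algC]. *)
Lemma Cyclotomic_prime n (a b : {poly int}) : (0 < n)%N ->
  ring_dvd 'Phi_n (a * b) -> ring_dvd 'Phi_n a \/ ring_dvd 'Phi_n b.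
Proof.
move=> /C_prim_root_exists[z prim_z]; rewrite !(ring_dvd_Cyclotomic _ prim_z).
by rewrite rmorphM rootM => /orP[]; [left | right].
Qed.

Lemma ring_dvd_Cyclotomic_inj i j : (0 < i)%N -> ring_dvd 'Phi_i 'Phi_j -> i = j.
Proof.
move=> /C_prim_root_exists[z prim_z]; rewrite (ring_dvd_Cyclotomic _ prim_z).
(* ['Phi_0] is 1, which has no root. *)
have [->|] := posnP j; first by rewrite Cyclotomic0 rmorph1 /root hornerC oner_eq0.
move=> /C_prim_root_exists[w prim_w].
rewrite (Cintr_Cyclotomic prim_w) root_cyclotomic // => prim_jz.
apply/eqP; rewrite eqn_dvd (prim_order_dvd prim_z) (prim_order_dvd prim_jz).
by rewrite !prim_expr_order ?eqxx.
Qed.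

Lemma ring_dvd_Cyclotomic1 i : (0 < i)%N -> ~ ring_dvd 'Phi_i 1.
Proof.
move=> /C_prim_root_exists[z prim_z].
by rewrite (ring_dvd_Cyclotomic _ prim_z) rmorph1 /root hornerC oner_eq0.
Qed.

Lemma Cyclotomic_irreducible n : (0 < n)%N -> irreducible_elt 'Phi_n.
Proof.
move=> n0; have PhiN0 : 'Phi_n != 0 by rewrite monic_neq0 ?Cyclotomic_monic.
(* If [a = c * 'Phi_n], cancelling ['Phi_n] leaves [b * c = 1]. *)
have unit_cofactor a b : 'Phi_n = a * b -> ring_dvd 'Phi_n a -> b \is a GRing.unit.
  move=> PhiE [c aE]; apply/unitrPr; exists c; apply: (mulIf PhiN0).
  by rewrite mul1r {2}PhiE aE -mulrA mulrC mulrAC.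
split=> // [|a b PhiE].
  apply/negP => /unitrP[c [c1 _]]; apply: (ring_dvd_Cyclotomic1 n0).
  by exists c.
have [|dv|dv] := @Cyclotomic_prime n a b n0.
- by exists 1; rewrite mul1r.
- by right; apply: unit_cofactor PhiE dv.
- by left; apply: (unit_cofactor b a) dv; rewrite mulrC.
Qed.

Lemma ring_dvd_prod_Cyclotomic i (r : seq nat) (P : pred nat) : (0 < i)%N ->
  ring_dvd 'Phi_i (\prod_(j <- r | P j) 'Phi_j) -> P i.
Proof.
move=> i0; elim: r => [|j r IHr].
  by rewrite big_nil => /(ring_dvd_Cyclotomic1 i0).
rewrite big_cons; case: ifP => [Pj|_]; last exact: IHr.
by case/(Cyclotomic_prime i0) => // /(ring_dvd_Cyclotomic_inj i0) ->.
Qed.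

(** One factor is removed at a time: if ['Phi_i] divides [e * d] but not [d], it divides [e] by
    primality and cancels. *)
Lemma ring_dvd_cancel_Cyclotomic (c d : {poly int}) (r : seq nat) (P : pred nat) :
  (forall i, P i -> (0 < i)%N /\ ~ ring_dvd 'Phi_i d) ->
  ring_dvd d (c * \prod_(i <- r | P i) 'Phi_i) -> ring_dvd d c.
Proof.
move=> Pd; elim: r => [|i r IHr]; first by rewrite big_nil mulr1.
rewrite big_cons; case: ifP => // /Pd[i0 Ndvd] [e eE]; apply: IHr.
have [|[f fE]|/Ndvd[]] := @Cyclotomic_prime i e d i0.
  by rewrite -eE mulrCA; exists (c * \prod_(j <- r | P j) 'Phi_j); rewrite mulrC.
exists f; apply: (mulIf (monic_neq0 (Cyclotomic_monic i))).
by rewrite [RHS]mulrAC -fE -eE -mulrA; congr (_ * _); apply: mulrC.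
Qed.

(** * Greatest common divisors in Z[X] *)

Lemma unit_poly_int (u : {poly int}) : u \is a GRing.unit -> u = 1 \/ u = -1.
Proof.
rewrite poly_unitE => /andP[/eqP sz]; rewrite (size1_polyC (eq_leq sz)) coefC /=.
case/orP=> /eqP->; first by left.
by right; rewrite polyCN.
Qed.

(** Two gcds divide each other, so they differ by a unit of Z[X], that is, by a sign. *)
Lemma is_gcd_poly_int (I : Type) (f : I -> {poly int}) (g h : {poly int}) :
  h != 0 -> is_gcd f h -> is_gcd f g <-> g = h \/ g = - h.
Proof.
move=> hN0 [hf fh]; split=> [[gf fg]|].
  have [[u uE] [v vE]] := (fh g gf, fg h hf).
  have /unit_poly_int[] : v \is a GRing.unit.
  - by apply/unitrPr; exists u; apply: (mulIf hN0); rewrite mul1r mulrAC -vE mulrC.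
  - by move=> v1; left; rewrite vE v1 mul1r.
  - by move=> v1; right; rewrite vE v1 mulN1r.
case=> ->; split=> // [i|d /fh[c ->]].
- by have [c ->] := hf i; exists (- c); rewrite mulrNN.
- by exists (- c); rewrite mulNr.
Qed.

(* If [n %% i < t], then [s = n %% i + 1] gives [(n - s) %% i = i - 1]. *)
Lemma cyc_indexP t n k i : (0 < i)%N -> (t <= k)%N -> (k <= n)%N ->
  reflect (forall s : 'I_t.+1, (n - s) %% i < (k - s) %% i)%N
          (cyc_index t n k i).
Proof.
move=> i0 tk kn.
have modB m s : (s <= m %% i)%N -> ((m - s) %% i = m %% i - s)%N.
  move=> sm; rewrite {1}(divn_eq m i) -addnBA // modnMDl modn_small //.
  by rewrite (leq_ltn_trans (leq_subr _ _)) ?ltn_pmod.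
apply: (iffP and3P) => [[_ tn nk] s|lt_mod].
  have st : (s <= t)%N by rewrite -ltnS.
  by rewrite !modB; lia.
have nk : (n %% i < k %% i)%N by have := lt_mod ord0; rewrite !subn0.
split=> //; rewrite leqNgt; apply/negP => nt.
have := lt_mod (Ordinal (nt : ((n %% i).+1 < t.+1)%N)) => /=.
(* If [n < i], then [n %% i = n], which is at least [t]. *)
have q0 : (0 < n %/ i)%N.
  by rewrite divn_gt0 // leqNgt; apply/negP => /modn_small ni; lia.
have -> : (n - (n %% i).+1 = (n %/ i).-1 * i + i.-1)%N.
  have := divn_eq n i; case: (n %/ i)%N q0 => // m _ /=; rewrite mulSn; lia.
rewrite modnMDl modn_small; last by rewrite prednK.
by have := ltn_pmod (k - (n %% i).+1) i0; lia.
Qed.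

Lemma is_gcd_gauss_bin t n k : (t <= k)%N -> (k <= n)%N ->
  is_gcd (fun s : 'I_t.+1 => gauss_bin (n - s) (k - s))
         (\prod_(1 <= i < n.+1 | cyc_index t n k i) 'Phi_i).
Proof.
move=> tk kn.
have binE (s : nat) : gauss_bin (n - s) (k - s)
    = \prod_(1 <= d < n.+1 | ((n - s) %% d < (k - s) %% d)%N) 'Phi_d.
  by apply: gauss_bin_Cyclotomic; rewrite ?ltnS ?leq_subr ?leq_sub2r.
have splitE (s : 'I_t.+1) : gauss_bin (n - s) (k - s)
    = \prod_(1 <= i < n.+1 | cyc_index t n k i) 'Phi_i
      * \prod_(1 <= i < n.+1 | ((n - s) %% i < (k - s) %% i)%N
                               && ~~ cyc_index t n k i) 'Phi_i.
  rewrite binE (bigID (cyc_index t n k)) /=; congr (_ * _).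
  apply: eq_bigl => i; apply: andb_idl => ci.
  have i0 : (0 < i)%N by case/and3P: ci.
  by move/(cyc_indexP i0 tk kn): ci.
split=> [s|d d_bin]; first by rewrite splitE mulrC; eexists.
(* The binomial with [s = 0] suffices: its factors ['Phi_i] outside the claimed gcd do not divide
   [d], so they cancel. *)
have := d_bin ord0; rewrite splitE; apply: ring_dvd_cancel_Cyclotomic.
move=> i /andP[nk /negP Nci].
(* Remainders modulo 0 are the numbers themselves, and [n < k] is excluded. *)
have i0 : (0 < i)%N by move: nk; rewrite lt0n; case: eqP => // ->; rewrite !modn0; lia.
(* If ['Phi_i] divided [d], it would divide every binomial, forcing [cyc_index]. *)
split=> // -[e dE]; case: Nci; apply/(cyc_indexP i0 tk kn) => s.
have [c cE] := d_bin s; rewrite binE in cE.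
apply: (@ring_dvd_prod_Cyclotomic i (index_iota 1 n.+1)
          (fun d => (n - s) %% d < (k - s) %% d)%N i0).
by exists (c * e); rewrite cE dE mulrA.
Qed.

(** * Admissibility and the least admissible integer *)

Lemma dvdz_mul_gcd (d l m n : int) :
  (d %| l * gcdz m n)%Z = (d %| l * m)%Z && (d %| l * n)%Z.
Proof.
by rewrite -dvdz_gcd !dvdzE abszM /gcdz !abszM /= muln_gcdr.
Qed.

Lemma dvdz_mul_biggcd (d l : int) m (f : 'I_m -> int) :
  reflect (forall s, d %| l * f s)%Z (d %| l * \big[gcdz/0]_(s < m) f s)%Z.
Proof.
(* The empty gcd 0 corresponds to [true], since [d] divides [l * 0]. *)
rewrite (big_morph (fun x => d %| l * x)%Z (dvdz_mul_gcd d l) (_ : _ = true)) ?mulr0 ?dvdz0 //.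
rewrite big_andE; exact: forallP.
Qed.

Lemma int_ratio_dvdz (d m : int) : d != 0 ->
  (m%:~R / d%:~R : rat) \is a Num.int = (d %| m)%Z.
Proof.
move=> dN0; have dQ : d%:~R != 0 :> rat by rewrite intr_eq0.
apply/intrP/dvdzP => -[c cE]; exists c; last by rewrite cE intrM mulfK.
by apply: (@intr_inj rat); rewrite intrM -cE divfK.
Qed.

Lemma admissibleE q t n k (l : int) : gauss_val q (n - t) (k - t) != 0 ->
  admissible q t n k l
    = (gauss_val q (n - t) (k - t) %| l * gauss_gcd q t n k)%Z.
Proof.
move=> dN0; apply/forallP/dvdz_mul_biggcd => adm s; have := adm s.
  by rewrite /lambda_s mulrAC -intrM int_ratio_dvdz // mulrC.
by rewrite /lambda_s mulrAC -intrM int_ratio_dvdz // mulrC.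
Qed.

Lemma gauss_gcd_dvd q t n k (s : 'I_t.+1) :
  (gauss_gcd q t n k %| gauss_val q (n - s) (k - s))%Z.
Proof.
(* The criterion is applied with [l = 1] and the gcd itself as divisor. *)
have /dvdz_mul_biggcd/(_ s) : (gauss_gcd q t n k %| 1 * gauss_gcd q t n k)%Z.
  by rewrite mul1r.
by rewrite mul1r.
Qed.

Lemma lambda_min_mul_gcd q t n k : 0 < gauss_val q (n - t) (k - t) ->
  (lambda_min q t n k)%:Z * gauss_gcd q t n k = gauss_val q (n - t) (k - t).
Proof.
move=> D0; set G := gauss_gcd q t n k; set D := gauss_val _ _ _.
(* [D] is the entry with [s = t]. *)
have /dvdzP[d DE] : (G %| D)%Z by have := @gauss_gcd_dvd q t n k ord_max.
have G_ge0 : 0 <= G by rewrite /G /gauss_gcd big_ord_recl.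
have DN0 : D != 0 by rewrite gt_eqF.
have G0 : 0 < G.
  by rewrite lt_def G_ge0 andbT; apply: contraNneq DN0 => GE; rewrite DE GE mulr0.
have d0 : 0 < d by rewrite -(pmulr_lgt0 _ G0) -DE.
rewrite DE; congr (_ * _); rewrite /lambda_min.
(* Cancelling [G] from [d * G %| l * G] shows that the admissible integers are the multiples of [d];
   the least positive one is [d]. *)
have adm (l : int) : admissible q t n k l = (d %| l)%Z.
  by rewrite admissibleE // -/D -/G DE dvdz_mul2r // gt_eqF.
case: ex_minnP => m /andP[m0]; rewrite adm => dm m_min.
case: d d0 adm dm {DE} => // d d0 adm dm; congr Posz; apply/eqP; rewrite eqn_leq.
by rewrite m_min ?d0 ?adm ?dvdzz //= dvdn_leq.
Qed.

Theorem lemma2p6 (q t k n : nat)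
  (hq : q = 1%N \/ exists p m : nat, [/\ prime p, (0 < m)%N & q = (p ^ m)%N])
  (htk : (t <= k)%N) (hkn : (k <= n)%N) :
  [/\ (lambda_min q t n k)%:R
        = (gauss_val q (n - t) (k - t))%:~R / (gauss_gcd q t n k)%:~R :> rat,
      (lambda_min q t n k)%:R
        = (lambda_max q t n k)%:~R / (gauss_gcd q t n k)%:~R :> rat,
      forall g : {poly int},
        is_gcd (fun s : 'I_t.+1 => gauss_bin (n - s) (k - s)) g <->
        (let P := \prod_(1 <= i < n.+1 | cyc_index t n k i) 'Phi_i in
         g = P \/ g = - P)
    & forall i : nat, cyc_index t n k i -> irreducible_elt 'Phi_i].
Proof.
have q0 : (0 < q)%N.
  by case: hq => [->|[p [m [p_pr _ ->]]]] //; rewrite expn_gt0 prime_gt0.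
have D0 : 0 < gauss_val q (n - t) (k - t) by rewrite gauss_val_gt0 ?leq_sub2r.
have lamE : (lambda_min q t n k)%:R
    = (gauss_val q (n - t) (k - t))%:~R / (gauss_gcd q t n k)%:~R :> rat.
  rewrite -(lambda_min_mul_gcd D0) intrM mulfK // intr_eq0.
  (* A zero gcd would make the positive [lambda_max] zero. *)
  apply/eqP => G0; have := lambda_min_mul_gcd D0; rewrite G0 mulr0 => DE.
  by rewrite -DE ltxx in D0.
split=> // [g|i /and3P[i0 _ _]]; last exact: Cyclotomic_irreducible.
apply: is_gcd_poly_int (is_gcd_gauss_bin htk hkn).
by rewrite monic_neq0 // monic_prod // => i _; apply: Cyclotomic_monic.
Qed.
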